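(* Let $K$ be an algebraically closed field, let $2\le m\le n$ be integers, and let $\Delta=\Delta_{LT(J)}$ be the Stanley-Reisner complex of the leading term ideal $LT(J)$ of the ideal $J$ of the principal component of the first-order jet scheme over the variety of $m\times n$ matrices of rank at most $1$. Let $F=F_xF_y$ be a facet of $\Delta$ with $\mu(F)=x_{i,j}$. Then $F_x$ is a path from $x_{i,j}$ to $x_{m,n}$, and $F_y$ is a family of non-intersecting paths from $y_{1,1},y_{2,1}$ to $y_{i,n},y_{m,j}$; that is, $F_y$ is the union of a path from $y_{1,1}$ to $y_{i,n}$ and a path from $y_{2,1}$ to $y_{m,j}$ having no vertex in common.
   Context: Let $R=K[x_{i,j},y_{i,j} : 1\le i\le m,\ 1\le j\le n]$, let $X(t)=(x_{i,j}+y_{i,j}t)_{i,j}$ be the generic $m\times n$ matrix over $K[t]/(t^2)$, and let $I\subseteq R$ be the ideal generated by the coefficients of the powers of $t$ in all $2\times 2$ minors of $X(t)$. Let $Y$ (the principal component) be the Zariski closure in $\mathbf{A}_K^{2mn}$ of the set of $(A,B)$ in the zero set of $I$ with $\operatorname{rank} A=1$ ($A$ giving the $x$-coordinates, $B$ the $y$-coordinates), and let $J\subseteq R$ be the ideal of all polynomials vanishing on $Y$. $LT(J)$ is the ideal of leading terms of $J$ for the graded reverse lexicographical order with $y_{1,1}>y_{1,2}>\dots>y_{1,n}>y_{2,1}>\dots>y_{m,n}>x_{1,1}>x_{1,2}>\dots>x_{1,n}>x_{2,1}>\dots>x_{m,n}$. It is known that $LT(J)$ is generated by the following squarefree monomials: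 $A=\{x_{i,l}x_{j,k} : 1\le i<j\le m,\ 1\le k<l\le n\}$, $B=\{x_{i,k}y_{j,l} : 1\le i<j\le m,\ 1\le k<l\le n\}$, $C=\{x_{k,p}y_{j,q}y_{i,r} : 1\le i<j\le k\le m,\ 1\le p<q<r\le n\}$, $D=\{x_{i,r}y_{j,q}y_{k,p} : 1\le i<j<k\le m,\ 1\le p<q\le r\le n\}$, $E=\{y_{i,r}y_{j,q}y_{k,p} : 1\le i<j<k\le m,\ 1\le p<q<r\le n\}$. The Stanley-Reisner complex $\Delta_{LT(J)}$ is the simplicial complex on the vertex set $\{x_{i,j},y_{i,j} : 1\le i\le m,\ 1\le j\le n\}$ whose faces are the subsets whose product, as a monomial, does not belong to $LT(J)$. A facet is a maximal face. A facet $F$ is written $F=F_xF_y$, where $F_x$ is the set of $x$-vertices and $F_y$ the set of $y$-vertices of $F$. For a facet $F$, the set $F_x$ is nonempty and there is a (unique) vertex $x_{i,j}\in F_x$ with $i\le c$ and $j\le d$ for all $x_{c,d}\in F_x$; this vertex is denoted $\mu(F)$. For $a\le c$ and $b\le d$, a path from $w_{a,b}$ to $w_{c,d}$ ($w=x$ or $w=y$) is a sequence of vertices starting at $w_{a,b}$ and ending at $w_{c,d}$ in which each vertex is either one step to the right ($w_{s,t}\to w_{s,t+1}$) or one step down ($w_{s,t}\to w_{s+1,t}$) from the previous one; a path is identified with its set of vertices. *)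

(* Defs.v *)
From HB Require Import structures.
From mathcomp Require Import all_boot all_order all_algebra.
From mathcomp Require Export mpoly.

Set Implicit Arguments.
Unset Strict Implicit.
Unset Printing Implicit Defensive.

Import GRing.Theory.
Local Open Scope ring_scope.

(* Indices are 0-based throughout: the entry written (i, j) on paper has
   ordinal indices i - 1 and j - 1. *)

Section Ideals.
Variable R : comNzRingType.

Definition ideal_span (S : R -> Prop) (f : R) : Prop :=
  exists s : seq (R * R),
    (forall p, p \in s -> S p.2) /\ f = \sum_(p <- s) p.1 * p.2.

End Ideals.

Section AffineSpace.
Variables (K : fieldType) (N : nat).
Implicit Types (Z : ('I_N -> K) -> Prop) (T : {mpoly K[N]} -> Prop).

Definition zero_set T : ('I_N -> K) -> Prop :=
  fun v => forall f, T f -> f.@[v] = 0.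

Definition zariski_closed Z : Prop :=
  exists T, forall v, Z v <-> zero_set T v.

Definition zariski_closure Z : ('I_N -> K) -> Prop :=
  fun v => forall Z', zariski_closed Z' -> (forall w, Z w -> Z' w) -> Z' v.

Definition vanishing_ideal Z : {mpoly K[N]} -> Prop :=
  fun f => forall v, Z v -> f.@[v] = 0.

End AffineSpace.

Section LeadingTerms.
Variables (K : fieldType) (N : nat).
Implicit Types (f t : {mpoly K[N]}) (L : {mpoly K[N]} -> Prop).

(* Strict graded reverse lexicographical order with 'X_0 > 'X_1 > ... .  The
   order `<=%O` that multinomials puts on 'X_{1..N} is graded lexicographical,
   in spite of what its header says, hence this separate definition. *)
Definition grevlex_lt (d e : 'X_{1..N}) : bool :=
  (mdeg d < mdeg e)%N ||
  (mdeg d == mdeg e) &&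
    [exists k : 'I_N, (e k < d k)%N &&
      [forall l : 'I_N, (k < l)%N ==> (d l == e l)]].

Definition is_leading_term f t : Prop :=
  exists d : 'X_{1..N},
    [/\ d \in msupp f,
        forall e, e \in msupp f -> e != d -> grevlex_lt e d
      & t = f@_d *: 'X_[d]].

Definition LT L : {mpoly K[N]} -> Prop :=
  ideal_span (fun t => exists2 f, L f & is_leading_term f t).

(* For a monomial ideal L: the Stanley-Reisner complex of L, on the variables. *)
Definition sr_face L (F : {set 'I_N}) : Prop := ~ L (\prod_(k in F) 'X_k).

Definition sr_facet L (F : {set 'I_N}) : Prop :=
  sr_face L F /\ forall G : {set 'I_N}, sr_face L G -> F \subset G -> G = F.

End LeadingTerms.

Section Vertices.
Variables m n : nat.

Lemma cell_subproof (i : 'I_m) (j : 'I_n) : (i * n + j < m * n)%N.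
Proof.
apply: (@leq_trans (i * n + n)); first by rewrite ltn_add2l.
by rewrite addnC -mulSn leq_mul2r ltn_ord orbT.
Qed.

Definition cell (i : 'I_m) (j : 'I_n) : 'I_(m * n) :=
  Ordinal (cell_subproof i j).

(* Row by row, all the y's before all the x's, so that for grevlex_lt
   y_{1,1} > y_{1,2} > ... > y_{m,n} > x_{1,1} > x_{1,2} > ... > x_{m,n}. *)
Definition yvar (i : 'I_m) (j : 'I_n) : 'I_(m * n + m * n) :=
  lshift (m * n) (cell i j).
Definition xvar (i : 'I_m) (j : 'I_n) : 'I_(m * n + m * n) :=
  rshift (m * n) (cell i j).

Implicit Types F : {set 'I_(m * n + m * n)}.

(* F_x and F_y, as sets of positions in the m x n grid. *)
Definition xpart F : {set 'I_m * 'I_n} := [set p | xvar p.1 p.2 \in F].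
Definition ypart F : {set 'I_m * 'I_n} := [set p | yvar p.1 p.2 \in F].

(* x_{i,j} is the vertex mu(F). *)
Definition is_mu F (i : 'I_m) (j : 'I_n) : Prop :=
  xvar i j \in F /\
  forall (c : 'I_m) (d : 'I_n), xvar c d \in F -> (i <= c)%N /\ (j <= d)%N.

Definition grid_step (p q : 'I_m * 'I_n) : bool :=
  (q.1 == p.1 :> nat) && (q.2 == p.2.+1 :> nat) ||
  (q.1 == p.1.+1 :> nat) && (q.2 == p.2 :> nat).

(* S is the set of vertices of a path from (a.1, a.2) to (b.1, b.2). *)
Definition is_path (S : {set 'I_m * 'I_n}) (a b : nat * nat) : Prop :=
  exists (p : 'I_m * 'I_n) (s : seq ('I_m * 'I_n)),
    [/\ (p.1 : nat, p.2 : nat) = a,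
        ((last p s).1 : nat, (last p s).2 : nat) = b,
        path grid_step p s
      & S = [set:: p :: s]].

End Vertices.

Section PrincipalComponent.
Variables (K : fieldType) (m n : nat).
Notation R := {mpoly K[m * n + m * n]}.

Definition jet_matrix : 'M[{poly R}]_(m, n) :=
  \matrix_(i, j) (('X_(xvar i j) : R)%:P + ('X_(yvar i j) : R)%:P * 'X).

(* Minors are computed in R[t]; reducing them modulo t^2 keeps exactly the
   coefficients of t^0 and t^1. *)
Definition jet_generator (f : R) : Prop :=
  exists (r : 'I_2 -> 'I_m) (c : 'I_2 -> 'I_n) (l : nat),
    [/\ {homo r : a b / (a < b)%N}, {homo c : a b / (a < b)%N}, (l < 2)%N
      & f = (\det (mxsub r c jet_matrix))`_l].

Definition jet_ideal : R -> Prop := ideal_span jet_generator.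

Definition x_matrix (v : 'I_(m * n + m * n) -> K) : 'M[K]_(m, n) :=
  \matrix_(i, j) v (xvar i j).

Definition principal_component : ('I_(m * n + m * n) -> K) -> Prop :=
  zariski_closure (fun v => zero_set jet_ideal v /\ \rank (x_matrix v) = 1%N).

Definition principal_ideal : R -> Prop := vanishing_ideal principal_component.

End PrincipalComponent.

(* Main.v *)
Require Import Defs.
From HB Require Import structures.
From mathcomp Require Import all_boot all_order all_algebra.
From mathcomp Require Import zify ring.

(* J is the kernel of the map x_ab -> u_a v_b, y_ab -> u_a w_b + z_a v_b, so
   the 2-minors of X(t) and suitable 3 x 3 determinants in the rows and columns
   of x and y lie in J, and no facet contains their leading monomials.  A set of
   variables avoiding these monomials is contained in a union G of paths X, P, Q
   as in the theorem, so by maximality of the facet it only remains to see that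
   G is a face.  The image of the monomial of G contains, with coefficient 1,
   the product of u_a v_b over X, of u_a w_b over P and of z_a v_b over Q.  Since
   X, P and Q are chains, an exchange argument on the degrees in u, v, w, z shows
   that no smaller monomial in x and y contributes to that product; hence the
   monomial of G is not the leading monomial of an element of J. *)

Set Implicit Arguments.
Unset Strict Implicit.
Unset Printing Implicit Defensive.

Import GRing.Theory.

(** * Exchange arguments for integer matrices with given margins *)

Lemma sum_eq_exists_lt (I : finType) (f g : I -> nat) (i0 : I) :
  \sum_i f i = \sum_i g i -> g i0 < f i0 -> exists i, f i < g i.
Proof.
move=> fg i0P; apply/existsP; apply: contraPT fg => /existsPn gf.
apply/eqP; rewrite gtn_eqF // (bigD1 i0) // [ltnRHS](bigD1 i0) //=.
by rewrite -addSn leq_add // leq_sum // => i _; rewrite leqNgt.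
Qed.

Lemma sumD_eq_exists_lt (I J : finType) (f g : I -> nat) (h k : J -> nat) (i0 : I) :
  \sum_i f i + \sum_j h j = \sum_i g i + \sum_j k j -> g i0 < f i0 ->
  (exists i, f i < g i) \/ (exists j, h j < k j).
Proof.
move=> fg i0P.
pose F (s : I + J) := match s with inl i => f i | inr j => h j end.
pose G (s : I + J) := match s with inl i => g i | inr j => k j end.
have FG : \sum_s F s = \sum_s G s by rewrite !big_sumType.
by have [[i|j] ltFG] := sum_eq_exists_lt (i0 := inl i0) FG i0P; [left; exists i | right; exists j].
Qed.

Section Exchange.
Variables m n : nat.
Implicit Types (S X P Q : 'I_m -> 'I_n -> nat).

(** Equivalently, the support of [S] is a chain for the componentwise order on cells. *)
Definition chain_fun S :=
  forall (a c : 'I_m) (b d : 'I_n), a < c -> 0 < S a b -> 0 < S c d -> b <= d.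

Lemma cell_lt (a c : 'I_m) (b d : 'I_n) :
  (cell a b < cell c d) = (a < c) || (a == c) && (b < d).
Proof.
rewrite /=; case: (ltngtP a c) => [ac|ca|ac] /=.
- have := ltn_ord b; have := leq_mul ac (leqnn n); rewrite mulSn; lia.
- have -> : (a == c) = false by apply/eqP => ac; rewrite ac ltnn in ca.
  have := ltn_ord d; have := leq_mul ca (leqnn n); rewrite mulSn; lia.
by rewrite (val_inj ac) eqxx ltn_add2l.
Qed.

Definition agree_after S S' (c : 'I_m) (d : 'I_n) :=
  forall a b, cell c d < cell a b -> S a b = S' a b.

(** Induction from the last cell backwards, because grevlex compares two monomials at the last
    variable where they differ. *)
Lemma cell_lt_ind (Pr : 'I_m -> 'I_n -> Prop) :
  (forall c d, (forall a b, cell c d < cell a b -> Pr a b) -> Pr c d) ->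
  forall c d, Pr c d.
Proof.
move=> IH c d.
have [k] := ubnP (m * n - cell c d); elim: k c d => // k IHk c d le_k.
apply: IH => a b lt_cd; apply: IHk.
have := ltn_ord (cell a b); have := ltn_ord (cell c d).
move: (cell a b : nat) (cell c d : nat) lt_cd le_k => x y; lia.
Qed.

(** The cells of row [c] to the right of [(c, d)] come later in the order, where [S] and [S']
    already agree. *)
Lemma deficit_left S S' (c : 'I_m) (b d : 'I_n) :
  agree_after S' S c d -> S c d < S' c d -> S' c b < S c b -> b < d.
Proof.
move=> agr lt_cd lt_b; case: ltngtP => // [db|/val_inj bd]; last by rewrite bd in lt_b; lia.
by rewrite agr ?ltnn // cell_lt eqxx db orbT in lt_b.
Qed.

Lemma deficit_above S S' (a c : 'I_m) (d : 'I_n) :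
  agree_after S' S c d -> S c d < S' c d -> S' a d < S a d -> a < c.
Proof.
move=> agr lt_cd lt_a; case: ltngtP => // [ca|/val_inj ca]; last by rewrite ca in lt_a; lia.
by rewrite agr ?ltnn // cell_lt ca in lt_a.
Qed.

(* An excess of S' at (c, d) forces a deficit to the left of it and one above
   it, hence an antidiagonal pair in S. *)
Lemma chain_exchange S S' (c : 'I_m) (d : 'I_n) :
  chain_fun S -> (\sum_b S' c b = \sum_b S c b) ->
  (\sum_a S' a d = \sum_a S a d) -> agree_after S' S c d -> S' c d <= S c d.
Proof.
move=> chS row col agr; rewrite leqNgt; apply/negP => lt_cd.
have [b lt_b] := sum_eq_exists_lt (f := S' c) row lt_cd.
have [a lt_a] := sum_eq_exists_lt (f := S' ^~ d) col lt_cd.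
have bd := deficit_left agr lt_cd lt_b; have ac := deficit_above agr lt_cd lt_a.
have := chS a c d b ac; lia.
Qed.

(** [X], [P] and [Q] count the factors u v, u w and z v, so the four margin equations fix the
    degrees in u, v, w and z. The last two hypotheses are what grevlex says at the last difference,
    first among the x-exponents, then among the y-exponents [P + Q]. *)
Lemma margins_exchange X P Q X' P' Q' (i : 'I_m) (j : 'I_n) :
  chain_fun X -> chain_fun P -> chain_fun Q ->
  (forall a b, 0 < X a b -> i <= a /\ j <= b) ->
  (forall a b, 0 < P a b -> a <= i) ->
  (forall a b, 0 < Q a b -> b <= j) ->
  (forall a, \sum_b X' a b + \sum_b P' a b = \sum_b X a b + \sum_b P a b) ->
  (forall b, \sum_a X' a b + \sum_a Q' a b = \sum_a X a b + \sum_a Q a b) ->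
  (forall b, \sum_a P' a b = \sum_a P a b) ->
  (forall a, \sum_b Q' a b = \sum_b Q a b) ->
  (forall c d, agree_after X' X c d -> X c d <= X' c d) ->
  ((forall a b, X' a b = X a b) -> forall c d,
     agree_after (fun a b => P' a b + Q' a b) (fun a b => P a b + Q a b) c d ->
     P c d + Q c d <= P' c d + Q' c d) ->
  forall a b, [/\ X' a b = X a b, P' a b = P a b & Q' a b = Q a b].
Proof.
move=> chX chP chQ Xij Pi Qj mu mv mw mz leX lePQ.
have XX : forall a b, X' a b = X a b.
  apply: cell_lt_ind => c d agr; apply/eqP; rewrite eqn_leq leX // andbT leqNgt.
  apply/negP => lt_cd.
  (* The degree in u_c forces a deficit in row [c] of [X] or [P], the degree in v_d one in column
     [d] of [X] or [Q]. Two deficits in [X] form an antidiagonal pair; one in [X] and one in [P] or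
     [Q] contradicts the position of the supports relative to [(i, j)]. *)
  have [[b lt_b]|[b lt_b]] := sumD_eq_exists_lt (f := X' c) (mu c) lt_cd;
  have [[a lt_a]|[a lt_a]] := sumD_eq_exists_lt (f := X' ^~ d) (mv d) lt_cd.
  - have bd := deficit_left agr lt_cd lt_b; have ac := deficit_above agr lt_cd lt_a.
    have := chX a c d b ac; lia.
  - have bd := deficit_left agr lt_cd lt_b.
    have := Qj a d; have := Xij c b; lia.
  - have ac := deficit_above agr lt_cd lt_a.
    have := Pi c b; have := Xij a d; lia.
  have ci : c <= i by apply: (Pi c b); lia.
  have dj : d <= j by apply: (Qj a d); lia.
  (* The margins determine the total mass of X', and all of X lies weakly
     after (c, d). *)
  have tot : \sum_a \sum_b X' a b = \sum_a \sum_b X a b.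
    have : \sum_a (\sum_b X' a b + \sum_b P' a b) = \sum_a (\sum_b X a b + \sum_b P a b).
      by apply: eq_bigr.
    rewrite !big_split /= (exchange_big _ _ _ _ _ P') (exchange_big _ _ _ _ _ P) /=.
    rewrite (eq_bigr _ (fun b _ => mw b)); exact: addIn.
  rewrite !pair_big /= in tot.
  have [[a' b'] /= lt_ab] := sum_eq_exists_lt (i0 := (c, d)) tot lt_cd.
  have [ia jb] : i <= a' /\ j <= b' by apply: Xij; lia.
  have [lt|le] := boolP (cell c d < cell a' b').
    by rewrite agr ?ltnn in lt_ab.
  move: le; rewrite cell_lt.
  case: (ltngtP c a') => [//|?|/val_inj ca] /=; first lia.
  rewrite ca eqxx /= => db; have db' : d = b' by apply: val_inj => /=; lia.
  by rewrite -ca -db' in lt_ab; lia.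
suff PQ : forall a b, P' a b = P a b /\ Q' a b = Q a b.
  by move=> a b; have [] := PQ a b.
apply: cell_lt_ind => c d agr.
(* With [X'] equal to [X], the u- and v-margins become row sums of [P'] and column sums of [Q'].
   Then [chain_exchange] bounds [P'] and [Q'] from above, while grevlex bounds their sum from
   below. *)
have mP a : \sum_b P' a b = \sum_b P a b.
  by have := mu a; rewrite (eq_bigr _ (fun b _ => XX a b)) => /addnI.
have mQ b : \sum_a Q' a b = \sum_a Q a b.
  by have := mv b; rewrite (eq_bigr _ (fun a _ => XX a b)) => /addnI.
have leP : P' c d <= P c d.
  by apply: chain_exchange => // a b /agr [].
have leQ : Q' c d <= Q c d.
  by apply: chain_exchange => // a b /agr [].
have : P c d + Q c d <= P' c d + Q' c d.
  by apply: lePQ => // a b /agr [-> ->].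
lia.
Qed.

End Exchange.

(** * Lattice paths and covering a set of cells by them *)

Section Paths.
Variables m n : nat.
Implicit Types (S X P Q : {set 'I_m * 'I_n}) (p q : 'I_m * 'I_n).

Definition chain_set S :=
  forall p q, p \in S -> q \in S -> p.1 < q.1 -> p.2 <= q.2.

Definition weak_se p q := (p.1 <= q.1) && (p.2 <= q.2).

Lemma weak_se_trans : transitive weak_se.
Proof.
by move=> q p r /andP[pq1 pq2] /andP[qr1 qr2]; rewrite /weak_se (leq_trans pq1) ?(leq_trans pq2).
Qed.

Lemma grid_step_weak_se p q : grid_step p q -> weak_se p q.
Proof. by rewrite /grid_step /weak_se; lia. Qed.

Lemma is_path_bounds S a b p : is_path S a b -> p \in S ->
  [/\ a.1 <= p.1, a.2 <= p.2, p.1 <= b.1 & p.2 <= b.2].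
Proof.
case=> p0 [s [<- <- /(sub_path grid_step_weak_se)]].
rewrite (path_sortedE weak_se_trans) => /andP[allp0 srt] -> /=.
rewrite inE in_cons => pin.
have le0 : weak_se p0 p.
  by case/predU1P: pin => [->|/(allP allp0)//]; rewrite /weak_se !leqnn.
have srt0 : path weak_se p0 s by rewrite (path_sortedE weak_se_trans) allp0.
have leL : weak_se p (last p0 s).
  move: srt0 pin; rewrite -in_cons => + pin; case/splitPl: pin => s1 s2 e.
  rewrite last_cat cat_path e => /andP[_].
  rewrite (path_sortedE weak_se_trans) => /andP[/allP al _].
  have := mem_last p s2; rewrite in_cons => /predU1P[->|/al//].
  by rewrite /weak_se !leqnn.
by case/andP: le0; case/andP: leL.
Qed.

Lemma is_path_chain S a b : is_path S a b -> chain_set S.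
Proof.
case=> p0 [s [_ _ /(sub_path grid_step_weak_se) pth ->]].
have {pth} : pairwise weak_se (p0 :: s) by rewrite -(sorted_pairwise weak_se_trans).
move/(pairwiseP p0) => pw p q; rewrite !inE -!in_cons => pin qin lt_pq.
move: pin qin lt_pq => /(nthP p0)[k lt_k <-] /(nthP p0)[l lt_l <-].
case: (ltngtP k l) => [kl|lk|->]; last by rewrite ltnn.
- by have /andP[] := pw k l lt_k lt_l kl.
- by have /andP[le1 _] := pw l k lt_l lt_k lk; rewrite ltnNge le1.
Qed.

Lemma is_path_rcons S a b q : is_path S a b ->
  ((q.1 == b.1 :> nat) && (q.2 == b.2.+1 :> nat) ||
   (q.1 == b.1.+1 :> nat) && (q.2 == b.2 :> nat)) ->
  is_path (q |: S) a (q.1 : nat, q.2 : nat).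
Proof.
case=> p [s [<- <- pth ->]] st; exists p, (rcons s q); split => //.
- by rewrite last_rcons.
- by rewrite rcons_path pth.
by apply/setP => r; rewrite !inE mem_rcons in_cons orbCA.
Qed.

Lemma is_path_row S a r c (d : nat) : r < m -> is_path S a (r, c) -> c <= d < n ->
  is_path (S :|: [set p : 'I_m * 'I_n | (p.1 == r :> nat) && (c < p.2 <= d)]) a (r, d).
Proof.
move=> lt_r pth; elim: d => [|d IHd] /andP[le_c lt_d].
  have c0 : c = 0 by lia.
  rewrite {}c0 in pth *.
  suff -> : [set p : 'I_m * 'I_n | (p.1 == r :> nat) && (0 < p.2 <= 0)] = set0.
    by rewrite setU0.
  by apply/setP => p; rewrite !inE; lia.
case: (ltngtP c d.+1) le_c => // [lt_c|c_d] _; last first.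
  suff -> : [set p : 'I_m * 'I_n | (p.1 == r :> nat) && (c < p.2 <= d.+1)] = set0.
    by rewrite setU0 -c_d.
  by apply/setP => p; rewrite !inE; lia.
have {}IHd : is_path (S :|: [set p : 'I_m * 'I_n | (p.1 == r :> nat) && (c < p.2 <= d)]) a (r, d).
  by apply: IHd; lia.
have := is_path_rcons (q := (Ordinal lt_r, Ordinal lt_d)) IHd.
rewrite /= !eqxx => /(_ isT).
congr is_path; apply/setP => -[p1 p2]; rewrite !inE -pair_eqE /= -!val_eqE /=.
by case: ((p1, p2) \in S) => /=; rewrite ?orbT //; lia.
Qed.

(** A path is encoded by a monotone [f]: it enters row [a] in column [f a] and leaves it in column
    [f a.+1]. *)
Definition rim (f : nat -> nat) (a0 a1 : nat) : {set 'I_m * 'I_n} :=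
  [set p : 'I_m * 'I_n | (a0 <= p.1 <= a1) && (f p.1 <= p.2 <= f p.1.+1)].

Lemma rim_is_path (f : nat -> nat) a0 a1 :
  {homo f : a b / a <= b} -> a0 <= a1 < m -> f a1.+1 < n ->
  is_path (rim f a0 a1) (a0, f a0) (a1, f a1.+1).
Proof.
move=> mono; elim: a1 => [|a1 IH] /andP[le_a lt_a] lt_f.
  have -> : a0 = 0 by lia.
  have lt0 : f 0 < n by apply: leq_ltn_trans lt_f; apply: mono.
  have pth0 : is_path [set (Ordinal lt_a, Ordinal lt0)] (0, f 0) (0, f 0).
    exists (Ordinal lt_a, Ordinal lt0), [::]; split => //.
    by apply/setP => p; rewrite !inE.
  have := is_path_row (d := f 1) lt_a pth0; rewrite mono // => /(_ lt_f).
  congr is_path; apply/setP => -[p1 p2]; rewrite !inE -pair_eqE /= -!val_eqE /=.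
  by have := mono 0 1 isT; case: p1 => -[|p1] /= _; lia.
case: (ltngtP a0 a1.+1) le_a => // [lt_a0|->] _; last first.
  have lt0 : f a1.+1 < n by apply: leq_ltn_trans lt_f; apply: mono.
  have pth0 : is_path [set (Ordinal lt_a, Ordinal lt0)] (a1.+1, f a1.+1) (a1.+1, f a1.+1).
    exists (Ordinal lt_a, Ordinal lt0), [::]; split => //.
    by apply/setP => p; rewrite !inE.
  have := is_path_row (d := f a1.+2) lt_a pth0; rewrite mono // => /(_ lt_f).
  congr is_path; apply/setP => -[p1 p2]; rewrite !inE -pair_eqE /= -!val_eqE /=.
  have := mono a1.+1 a1.+2 (leqnSn _).
  case: (eqVneq (p1 : nat) a1.+1) => [->|]; lia.
have lt0 : f a1.+1 < n by apply: leq_ltn_trans lt_f; apply: mono.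
have {IH} pth : is_path (rim f a0 a1) (a0, f a0) (a1, f a1.+1) by apply: IH => //; lia.
have := is_path_rcons (q := (Ordinal lt_a, Ordinal lt0)) pth.
rewrite /= !eqxx orbT => /(_ isT) {}pth.
have := is_path_row (d := f a1.+2) lt_a pth; rewrite mono // => /(_ lt_f).
congr is_path; apply/setP => -[p1 p2]; rewrite !inE -pair_eqE /= -!val_eqE /=.
have := mono a1.+1 a1.+2 (leqnSn _).
case: (eqVneq (p1 : nat) a1.+1) => [->|]; lia.
Qed.

(** Entry columns of the south-westernmost path through a chain [S], with value 0 when [S] has no
    cell above row [a]. *)
Definition reach S (a : nat) : nat := \max_(p in S | p.1 < a) p.2.

Lemma reach_homo S : {homo reach S : a b / a <= b}.
Proof.
move=> a b le_ab; apply/bigmax_leqP => p /andP[pS lt_p].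
by apply: (bigmax_sup p) => //; rewrite pS (leq_trans lt_p).
Qed.

Lemma leq_reach S p a : p \in S -> p.1 < a -> p.2 <= reach S a.
Proof. by move=> pS lt_p; apply: (bigmax_sup p) => //; rewrite pS. Qed.

Lemma reach_leqP S a b :
  reflect (forall p, p \in S -> p.1 < a -> p.2 <= b) (reach S a <= b).
Proof.
apply: (iffP (bigmax_leqP _ _ _)) => H p; first by move=> pS lt_p; apply: H; rewrite pS.
by case/andP; apply: H.
Qed.

(* The paths run as far to the south-west as the faces allow: each cell is put
   on the upper path unless a cell strictly to the north-east of it is in S. *)
Lemma cover_by_paths (T S : {set 'I_m * 'I_n}) (i j : nat) :
  1 < m -> 1 < n -> i < m -> j < n -> (i < m.-1) || (j < n.-1) ->
  chain_set T -> (forall p, p \in T -> i <= p.1 /\ j <= p.2) ->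
  (forall p, p \in S -> (p.1 <= i) || (p.2 <= j)) ->
  (forall p q, p \in S -> q \in S -> p.1 < q.1 -> q.2 < p.2 -> q.1 <= i -> q.2 <= j) ->
  (forall p q, p \in S -> q \in S -> p.1 < q.1 -> q.2 < p.2 -> i < p.1 -> False) ->
  (forall p q r, p \in S -> q \in S -> r \in S ->
     p.1 < q.1 < r.1 -> r.2 < q.2 < p.2 -> False) ->
  exists X P Q : {set 'I_m * 'I_n},
    [/\ is_path X (i, j) (m.-1, n.-1), is_path P (0, 0) (i, n.-1),
        is_path Q (1, 0) (m.-1, j), [disjoint P & Q]
      & T \subset X /\ S \subset P :|: Q].
Proof.
move=> m_gt1 n_gt1 lt_i lt_j ij_neq chT geT SB SC SD SE.
(* In [hX], [hP] and [hQ], the value just past the last row of a path is the column where the path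
   has to end. *)
pose hX a := if m <= a then n.-1 else maxn j (reach T a).
(* After row 0 the upper path avoids column 0, where the lower one starts. In the last row it stays
   to the right of column [j], where the lower one ends; [ij_neq] leaves room for this. *)
pose hP a := if i < a then n.-1 else
             if a == 0 then 0 else maxn (maxn 1 (reach S a)) ((a == m.-1) * j.+1).
(* The cells of [S] that the upper path misses. *)
pose S2 := [set p in S | (i < p.1) || (p.2 < hP p.1)].
pose hQ a := if m <= a then j else reach S2 a.
have lt_ord2 (p : 'I_m * 'I_n) : p.1 < m /\ p.2 < n by [].
have reach_lt U a : reach U a <= n.-1.
  by apply/reach_leqP => p _ _; have := lt_ord2 p; lia.
have hX_homo : {homo hX : a b / a <= b}.
  move=> a b le_ab; rewrite /hX.
  have := reach_homo T le_ab; have := reach_lt T a; have := reach_lt T b.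
  case: (leqP m a); case: (leqP m b); lia.
have hP_homo : {homo hP : a b / a <= b}.
  move=> a b le_ab; rewrite /hP.
  have := reach_homo S le_ab; have := reach_lt S a; have := reach_lt S b.
  case: (ltnP i a); case: (ltnP i b); case: (eqVneq a 0); case: (eqVneq b 0);
  case: (eqVneq a m.-1); case: (eqVneq b m.-1); lia.
(* One alternative for each term of the maximum in [hP]. *)
have blocked (p : 'I_m * 'I_n) : p \in S2 -> p.1 <= i ->
    [\/ exists2 q : 'I_m * 'I_n, q \in S & (q.1 < p.1) /\ (p.2 < q.2),
        p.2 = 0 :> nat | p.1 = m.-1 :> nat /\ p.2 <= j].
  rewrite inE => /andP[pS +] le_i; rewrite [i < _]ltnNge le_i /= /hP [i < _]ltnNge le_i /=.
  case: eqP => // p1_neq0; rewrite !leq_max -!orbA.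
  case/or3P => [|lt_r|].
  - by rewrite ltnS leqn0 => /eqP; constructor 2.
  - constructor 1; move: lt_r; rewrite ltnNge => /reach_leqP H.
    case: (pickP [pred q | (q \in S) && (q.1 < p.1) && (p.2 < q.2)]) => [q|none].
      by rewrite /= => /andP[/andP[qS ?] ?]; exists q.
    case: H => q qS q1; have := none q; rewrite /= qS q1 /=; lia.
  - case: eqP => // e; rewrite ?mul1n ?mul0n // => ?; constructor 3; split=> //; lia.
have S2_j (p : 'I_m * 'I_n) : p \in S2 -> p.2 <= j.
  move=> pS2; have pS : p \in S by move: pS2; rewrite inE => /andP[].
  have := SB p pS; case: (leqP p.1 i) => //= le_i _.
  have [[q qS [q1 q2]]|->|[_]] // := blocked p pS2 le_i.
  exact: (SC q p).
(* A cell of [S] blocking the upper cell of an antidiagonal pair in [S2] completes it to an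
   antidiagonal of length three. *)
have chS2 : chain_set S2.
  move=> p q pS2 qS2 lt_pq; rewrite leqNgt; apply/negP => lt_qp.
  have pS : p \in S by move: pS2; rewrite inE => /andP[].
  have qS : q \in S by move: qS2; rewrite inE => /andP[].
  have [le_i|gt_i] := leqP p.1 i; last exact: (SD p q).
  have [[r rS [r1 r2]]|p2|[p1 _]] := blocked p pS2 le_i.
  - by apply: (SE r p q) => //; apply/andP.
  - by rewrite p2 in lt_qp.
  - by have := lt_ord2 q; lia.
have S2_row (p : 'I_m * 'I_n) : p \in S2 -> 0 < p.1.
  rewrite inE => /andP[pS]; rewrite lt0n; case: eqP => // ->.
  by rewrite /hP !ltn0.
have hQ_homo : {homo hQ : a b / a <= b}.
  move=> a b le_ab; rewrite /hQ.
  have := reach_homo S2 le_ab.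
  have le_j c : reach S2 c <= j by apply/reach_leqP => p /S2_j.
  have := le_j a; have := le_j b.
  case: (leqP m a); case: (leqP m b); lia.
exists (rim hX i m.-1), (rim hP 0 i), (rim hQ 1 m.-1).
have Em : m.-1.+1 = m by lia.
split.
- have hXi : hX i = j.
    rewrite /hX leqNgt lt_i /=; apply/maxn_idPl/reach_leqP => p /geT[]; lia.
  have hXm : hX m.-1.+1 = n.-1 by rewrite /hX Em leqnn.
  have := rim_is_path (a0 := i) (a1 := m.-1) hX_homo; rewrite hXi hXm; apply; lia.
- have hP0 : hP 0 = 0 by [].
  have hPi : hP i.+1 = n.-1 by rewrite /hP leqnn.
  have := rim_is_path (a0 := 0) (a1 := i) hP_homo; rewrite hP0 hPi; apply; lia.
- have hQ1 : hQ 1 = 0.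
    rewrite /hQ leqNgt m_gt1 /=; apply/eqP; rewrite -leqn0; apply/reach_leqP => p /S2_row.
    lia.
  have hQm : hQ m.-1.+1 = j by rewrite /hQ Em leqnn.
  have := rim_is_path (a0 := 1) (a1 := m.-1) hQ_homo; rewrite hQ1 hQm; apply; lia.
(* In a common row the lower path stops before the upper one enters, [hQ p1.+1 < hP p1]: outside the
   last row and column 0, each cell of [S2] up to row [p1] lies left of a cell of [S] in an earlier
   row. *)
- rewrite -setI_eq0; apply/eqP/setP => -[p1 p2]; rewrite !inE; apply/negP => /=.
  case/andP => /andP[le_i /andP[leP _]] /andP[/andP[p_gt0 _] /andP[_]].
  apply/negP; rewrite -ltnNge; apply: leq_trans leP.
  rewrite /hP [i < _]ltnNge le_i /= eqn0Ngt p_gt0 /= !leq_max -!orbA /hQ.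
  have [le_m|lt_m] := leqP m p1.+1.
    have -> : (p1 == m.-1 :> nat) by have := ltn_ord p1; lia.
    by rewrite mul1n leqnn !orbT.
  have [->|reach_gt0] := posnP (reach S2 p1.+1); first by [].
  suff -> : reach S2 p1.+1 < reach S p1 by rewrite orbT.
  have : ~~ (reach S2 p1.+1 <= (reach S2 p1.+1).-1) by lia.
  apply: contraNT; rewrite -leqNgt => le_r.
  apply/reach_leqP => q qS2 q1.
  have [|[r rS [r1 r2]]|->|[]] // := blocked q qS2.
  + lia.
  + have := leq_reach (a := p1) rS; lia.
  + lia.
split; apply/subsetP => -[p1 p2] pin.
- rewrite inE /hX /=; have [/= ip jp] := geT _ pin; have [/= pm pn] := lt_ord2 (p1, p2).
  have -> : i <= p1 <= m.-1 by lia.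
  rewrite [m <= p1]leqNgt pm /= geq_max jp /=; apply/andP; split.
    by apply/reach_leqP => q qT q1; apply: (chT q (p1, p2)).
  case: ifP => _; first lia.
  by rewrite leq_max (leq_reach pin) ?orbT.
- have [/= pm pn] := lt_ord2 (p1, p2); rewrite inE.
  have [pS2|] := boolP ((p1, p2) \in S2).
    apply/orP; right; rewrite inE (S2_row _ pS2) /= /hQ.
    have -> : p1 <= m.-1 by lia.
    rewrite [m <= p1]leqNgt pm /=; apply/andP; split.
      by apply/reach_leqP => q qS2 q1; apply: (chS2 q (p1, p2)).
    case: ifP => _; first exact: S2_j pS2.
    exact: leq_reach pS2 _.
  rewrite inE pin negb_or -!leqNgt /= => /andP[le_i leP].
  apply/orP; left; rewrite inE /= le_i leP /= /hP.
  case: ifP => [_|_] /=; first lia.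
  by rewrite !leq_max (leq_reach pin) ?orbT.
Qed.

End Paths.

(** * The graded reverse lexicographical order and leading monomials *)

Section Grevlex.
Variable N : nat.
Implicit Types d e f : 'X_{1..N}.

Lemma grevlex_lt_irr d : grevlex_lt d d = false.
Proof.
rewrite /grevlex_lt ltnn eqxx /=. apply/negbTE/existsPn => k.
by rewrite ltnn.
Qed.

Lemma grevlex_ltD2r f d e : grevlex_lt (d + f)%MM (e + f)%MM = grevlex_lt d e.
Proof.
rewrite /grevlex_lt !mdegD ltn_add2r eqn_add2r; congr (_ || _ && _).
apply: eq_existsb => k; rewrite !mnmDE ltn_add2r; congr (_ && _).
by apply: eq_forallb => l; rewrite !mnmDE eqn_add2r.
Qed.

(** The last variable of [d] does not occur in [e], and neither monomial involves a later one. *)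
Lemma grevlex_lt_var d e (k : 'I_N) : mdeg d = mdeg e -> 0 < d k ->
  (forall l : 'I_N, k <= l -> e l = 0) -> grevlex_lt d e.
Proof.
move=> deg dk e0; rewrite /grevlex_lt deg eqxx /=; apply/orP; right.
case: (@arg_maxnP 'I_N k (fun l => 0 < d l) val dk) => l dl lmax.
have le_kl : k <= l by apply: lmax.
apply/existsP; exists l; rewrite e0 // dl /=.
apply/forallP => l'; apply/implyP => lt_l; rewrite e0; last lia.
by rewrite eqn0Ngt; apply/negP => /lmax /=; lia.
Qed.

End Grevlex.

Section LeadingMonomial.
Variables (K : fieldType) (N : nat).
Implicit Types (d e : 'X_{1..N}) (g : {mpoly K[N]}) (F : {set 'I_N}).
Local Open Scope ring_scope.

Definition below d g : Prop := forall e, e \in msupp g -> grevlex_lt e d.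

Lemma belowD d g1 g2 : below d g1 -> below d g2 -> below d (g1 + g2).
Proof. by move=> b1 b2 e /msuppD_le; rewrite mem_cat => /orP[/b1|/b2]. Qed.

Lemma belowN d g : below d g -> below d (- g).
Proof. by move=> b e; rewrite (perm_mem (msuppN g)) => /b. Qed.

Lemma below_mpolyX d e : grevlex_lt e d -> below d 'X_[e].
Proof. by move=> lt_e e'; rewrite msuppX inE => /eqP->. Qed.

Lemma below_is_leading_term d g : below d g -> is_leading_term ('X_[d] + g) 'X_[d].
Proof.
move=> b; have g_d : g@_d = 0.
  by apply: memN_msupp_eq0; apply/negP => /b; rewrite grevlex_lt_irr.
have lead : ('X_[d] + g)@_d = 1 by rewrite mcoeffD mcoeffX eqxx g_d addr0.
exists d; split; first by rewrite mcoeff_msupp lead oner_eq0.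
  move=> e /msuppD_le; rewrite mem_cat msuppX inE => /orP[->//|/b //].
by rewrite lead scale1r.
Qed.

Definition mnm_set F : 'X_{1..N} := [multinom (k \in F : nat) | k < N].

Lemma prod_mpolyX F : \prod_(k in F) 'X_k = 'X_[mnm_set F] :> {mpoly K[N]}.
Proof.
rewrite mpolyXE_id big_mkcond; apply: eq_bigr => k _; rewrite mnmE.
by case: (k \in F).
Qed.

Lemma sr_face_below (L : {mpoly K[N]} -> Prop) F d g :
  sr_face (LT L) F -> L ('X_[d] + g) -> below d g -> ~ (d <= mnm_set F)%MM.
Proof.
move=> faceF Lf bel le_d; apply: faceF; rewrite prod_mpolyX -(submK le_d) mpolyXD.
exists [:: ('X_[mnm_set F - d], 'X_[d])]; split; last by rewrite big_seq1.
move=> p; rewrite inE => /eqP-> /=; exists ('X_[d] + g) => //.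
exact: below_is_leading_term.
Qed.

Lemma below2 (a b c d : 'I_N) :
  (a < d)%N -> (b < d)%N -> below (U_(a) + U_(b)) ('X_c * 'X_d).
Proof.
move=> ad bd; rewrite -mpolyXD; apply: below_mpolyX.
apply: (grevlex_lt_var (k := d)); rewrite ?mdegD ?mdeg1 // ?mnmDE ?mnm1E ?eqxx ?addnS //.
move=> l dl; rewrite mnmDE !mnm1E -!val_eqE /=; lia.
Qed.

Lemma below3 (a b c d e f : 'I_N) :
  (a < f)%N -> (b < f)%N -> (c < f)%N ->
  below (U_(a) + U_(b) + U_(c)) ('X_d * 'X_e * 'X_f).
Proof.
move=> af bf cf; rewrite -!mpolyXD; apply: below_mpolyX.
apply: (grevlex_lt_var (k := f)); rewrite ?mdegD ?mdeg1 // ?mnmDE ?mnm1E ?eqxx ?addnS //.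
move=> l dl; rewrite !mnmDE !mnm1E -!val_eqE /=; lia.
Qed.

(** The common variable [c], which may come after [e], cancels and leaves a comparison in degree
    two. *)
Lemma below3_shift (a b c d e : 'I_N) :
  (a < e)%N -> (b < e)%N -> below (U_(a) + U_(b) + U_(c)) ('X_d * 'X_e * 'X_c).
Proof.
move=> ae be; rewrite -!mpolyXD; apply: below_mpolyX; rewrite grevlex_ltD2r.
by have := below2 (c := d) ae be; apply; rewrite -mpolyXD msuppX inE.
Qed.

Lemma mnm_set_ge2 F (a b : 'I_N) :
  a != b -> a \in F -> b \in F -> (U_(a) + U_(b) <= mnm_set F)%MM.
Proof.
move=> ab aF bF; apply/mnm_lepP => k; rewrite mnmDE !mnm1E mnmE.
case: (eqVneq a k) => [<-|_] /=; first by rewrite aF eq_sym (negbTE ab).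
by case: (eqVneq b k) => [<-|_] //; rewrite bF.
Qed.

Lemma mnm_set_ge3 F (a b c : 'I_N) :
  uniq [:: a; b; c] -> a \in F -> b \in F -> c \in F ->
  (U_(a) + U_(b) + U_(c) <= mnm_set F)%MM.
Proof.
rewrite /= !inE negb_or andbT => /andP[/andP[ab ac] bc] aF bF cF.
apply/mnm_lepP => k; rewrite !mnmDE !mnm1E mnmE.
case: (eqVneq a k) => [<-|_] /=.
  by rewrite aF eq_sym (negbTE ab) eq_sym (negbTE ac).
case: (eqVneq b k) => [<-|_] /=; first by rewrite bF eq_sym (negbTE bc).
by case: (eqVneq c k) => [<-|_] //; rewrite cF.
Qed.

End LeadingMonomial.

(** * Parametrization of the principal component *)

Section Parametrization.
Variables (K : fieldType) (m n : nat).
Implicit Types (f : {mpoly K[m * n + m * n]}) (p : 'I_(m * n + m * n) -> K).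
Local Open Scope ring_scope.

(** With A and B the matrices of x- and y-coordinates of [p], this says that A + tB is the column u
    + tz times the row v + tw, modulo t^2. *)
Definition tangent_point p (u z : 'I_m -> K) (v w : 'I_n -> K) : Prop :=
  (forall a b, p (xvar a b) = u a * v b) /\
  (forall a b, p (yvar a b) = u a * w b + z a * v b).

Definition pair_ord k (a b : 'I_k) (t : 'I_2) : 'I_k := if t == 0 then a else b.

Lemma pair_ord_homo k (a b : 'I_k) :
  (a < b)%N -> {homo pair_ord a b : s t / (s < t)%N}.
Proof. by move=> ab s t; rewrite /pair_ord; case: s t => [[|[|]]//= ?] [[|[|]]//= ?]. Qed.

Lemma det_mx2 (R : comPzRingType) (A : 'M[R]_2) :
  \det A = A 0 0 * A 1 1 - A 0 1 * A 1 0.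
Proof.
rewrite (expand_det_row _ 0) !big_ord_recl big_ord0 /cofactor !det_mx11 !mxE /=.
rewrite addr0 expr0 expr1 mul1r mulN1r mulrN.
by congr (A _ _ * A _ _ - A _ _ * A _ _); apply: val_inj.
Qed.

Lemma jet_minor (r : 'I_2 -> 'I_m) (c : 'I_2 -> 'I_n) :
  let x i j : {mpoly K[m * n + m * n]} := 'X_(xvar (r i) (c j)) in
  let y i j : {mpoly K[m * n + m * n]} := 'X_(yvar (r i) (c j)) in
  \det (mxsub r c (jet_matrix K m n)) =
  (x 0 0 * x 1 1 - x 0 1 * x 1 0)%:P +
  (x 0 0 * y 1 1 + y 0 0 * x 1 1 - x 0 1 * y 1 0 - y 0 1 * x 1 0)%:P * 'X +
  (y 0 0 * y 1 1 - y 0 1 * y 1 0)%:P * 'X^2.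
Proof.
move=> x y; rewrite det_mx2 !mxE -/(x _ _).
rewrite !(rmorphD, rmorphB, rmorphM) /=; ring.
Qed.

Lemma coef01_quadratic (R : nzRingType) (a b c : R) :
  (a%:P + b%:P * 'X + c%:P * 'X^2)`_0 = a /\ (a%:P + b%:P * 'X + c%:P * 'X^2)`_1 = b.
Proof. by rewrite !coefD !coefMX !coefMXn !coefC /= !(addr0, add0r). Qed.

Lemma zero_set_jet_ideal_sub p (a b : 'I_m) (c d : 'I_n) :
  let x i j := p (xvar i j) in let y i j := p (yvar i j) in
  (a < b)%N -> (c < d)%N -> zero_set (@jet_ideal K m n) p ->
  x a c * x b d = x a d * x b c /\
  x a c * y b d + y a c * x b d = x a d * y b c + y a d * x b c.
Proof.
move=> x y ab cd zp.
have zl l : (l < 2)%N ->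
    ((\det (mxsub (pair_ord a b) (pair_ord c d) (jet_matrix K m n)))`_l).@[p] = 0.
  move=> l2; apply: zp.
  exists [:: (1, (\det (mxsub (pair_ord a b) (pair_ord c d) (jet_matrix K m n)))`_l)].
  split; last by rewrite big_seq1 mul1r.
  move=> q; rewrite inE => /eqP-> /=.
  by exists (pair_ord a b), (pair_ord c d), l; split=> //; apply: pair_ord_homo.
move: (zl 0 isT) (zl 1 isT); rewrite jet_minor.
rewrite !(coef01_quadratic _ _ _).1 !(coef01_quadratic _ _ _).2.
rewrite !(mevalD, mevalN, mevalM) !mevalXU => e0 e1.
split; apply/eqP; rewrite -subr_eq0; first exact/eqP/e0.
by rewrite opprD addrA; apply/eqP/e1.
Qed.

Lemma zero_set_jet_ideal p (a b : 'I_m) (c d : 'I_n) :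
  let x i j := p (xvar i j) in let y i j := p (yvar i j) in
  zero_set (@jet_ideal K m n) p ->
  x a c * x b d = x a d * x b c /\
  x a c * y b d + y a c * x b d = x a d * y b c + y a d * x b c.
Proof.
move=> x y zp.
have /= E := zero_set_jet_ideal_sub _ _ zp; rewrite /x /y {x y}.
have lin (s t s' t' : K) : s = t -> s' - t' = t - s -> s' = t'.
  by move=> ->; rewrite subrr => /eqP; rewrite subr_eq0 => /eqP.
case: (ltngtP a b) => [ab|ba|/val_inj ->]; last by split; ring.
- case: (ltngtP c d) => [cd|dc|/val_inj ->]; last by split; ring.
  + exact: E.
  + by have [e0 e1] := E _ _ _ _ ab dc; split; rewrite ?e0 ?e1.
- case: (ltngtP c d) => [cd|dc|/val_inj ->]; last by split; ring.
  + by have [e0 e1] := E _ _ _ _ ba cd; split; [apply: lin e0 _ | apply: lin e1 _]; ring.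
  + by have [/esym e0 /esym e1] := E _ _ _ _ ba dc; split; [apply: lin e0 _ | apply: lin e1 _]; ring.
Qed.

Lemma zero_set_jet_tangent_point p :
  zero_set (@jet_ideal K m n) p -> \rank (x_matrix p) = 1 ->
  exists u z v w, tangent_point p u z v w.
Proof.
move=> zp rk.
have [i0 [j0 nz]] : exists i0 j0, p (xvar i0 j0) != 0.
  case: (pickP (fun ij => p (xvar ij.1 ij.2) != 0)) => [[a b] nz|x0].
    by exists a, b.
  have : x_matrix p = 0 by apply/matrixP => a b; rewrite !mxE; have /negbFE/eqP := x0 (a, b).
  by move=> xm0; rewrite xm0 mxrank0 in rk.
pose x a b := p (xvar a b); pose y a b := p (yvar a b).
(* Normalized at the pivot x_{i0,j0}: u is its column in x, v and w are its rows in x and y divided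
   by the pivot, and the correction in z makes z vanish at [i0]. *)
exists (x ^~ j0), (fun a => y a j0 - x a j0 * y i0 j0 / x i0 j0).
exists (fun b => x i0 b / x i0 j0), (fun b => y i0 b / x i0 j0).
have E a b : x a b * x i0 j0 = x a j0 * x i0 b /\
    x a b * y i0 j0 + y a b * x i0 j0 = x a j0 * y i0 b + y a j0 * x i0 b.
  exact: (zero_set_jet_ideal a i0 b j0 zp).
rewrite -/(x i0 j0) in nz; split=> a b; have [e0 e1] := E a b; rewrite -?/(x a b) -?/(y a b).
  by rewrite mulrA -e0 mulfK.
apply: (mulIf nz).
have -> : y a b * x i0 j0 = x a j0 * y i0 b + y a j0 * x i0 b - x a b * y i0 j0.
  by rewrite -e1; ring.
have -> : x a b = x a j0 * x i0 b / x i0 j0 by rewrite -e0 mulfK.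
by field; exact: nz.
Qed.

(** The zero set of [f] is closed and contains the rank one points, which are all parametrized. *)
Lemma principal_ideal_intro f :
  (forall p u z v w, tangent_point p u z v w -> f.@[p] = 0) ->
  principal_ideal f.
Proof.
move=> f0 p /(_ (zero_set (eq f))) clos.
apply: (clos _ _ f erefl); first by exists (eq f).
move=> q [zq rq] _ <-.
by have [u [z [v [w /f0]]]] := zero_set_jet_tangent_point zq rq.
Qed.

(** The conditions on [u] and [v] make the x-matrix nonzero, hence of rank exactly 1. *)
Lemma tangent_point_mem p u z v w a b :
  tangent_point p u z v w -> u a != 0 -> v b != 0 -> principal_component p.
Proof.
move=> [px py] ua vb Z' _; apply; split.
  move=> _ [s [sgen ->]]; rewrite raddf_sum big_seq big1 //= => q /sgen.
  case=> r [c [l [_ _ l2 ->]]]; rewrite mevalM jet_minor.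
  case: l l2 => [|[|//]] _; rewrite ((coef01_quadratic _ _ _).1, (coef01_quadratic _ _ _).2);
    rewrite !(mevalD, mevalN, mevalM) !mevalXU !px ?py; ring.
apply/eqP; rewrite eqn_leq; apply/andP; split.
  have -> : x_matrix p = (\col_i u i) *m (\row_j v j).
    by apply/matrixP => c d; rewrite !mxE big_ord1 !mxE px.
  exact: leq_trans (mxrankM_maxl _ _) (rank_leq_col _).
rewrite lt0n mxrank_eq0; apply/eqP => /matrixP/(_ a b); rewrite !mxE px.
by apply/eqP; rewrite mulf_neq0.
Qed.

End Parametrization.

(** * Monomials that no face contains *)

Section Nonfaces.
Variables (K : fieldType) (m n : nat).
Notation R := {mpoly K[m * n + m * n]}.
Implicit Types F : {set 'I_(m * n + m * n)}.
Local Open Scope ring_scope.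

Lemma xvar_lt (a c : 'I_m) (b d : 'I_n) :
  (xvar a b < xvar c d)%N = (a < c)%N || (a == c) && (b < d)%N.
Proof. by rewrite /= ltn_add2l -cell_lt. Qed.

Lemma yvar_lt (a c : 'I_m) (b d : 'I_n) :
  (yvar a b < yvar c d)%N = (a < c)%N || (a == c) && (b < d)%N.
Proof. by rewrite -cell_lt. Qed.

Lemma yvar_lt_xvar (a c : 'I_m) (b d : 'I_n) : (yvar a b < xvar c d)%N.
Proof. by rewrite /= ltn_addr // (ltn_ord (cell a b)). Qed.

Let var_lt := (xvar_lt, yvar_lt, yvar_lt_xvar, eqxx, orbT).

Lemma face_no_xx F (i j : 'I_m) (k l : 'I_n) :
  sr_face (LT (@principal_ideal K m n)) F -> (i < j)%N -> (k < l)%N ->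
  xvar i l \in F -> xvar j k \in F -> False.
Proof.
move=> fF ij kl F1 F2.
pose x i j : R := 'X_(xvar i j).
have : principal_ideal ('X_[U_(xvar i l) + U_(xvar j k)] - x i k * x j l).
  apply: principal_ideal_intro => p u z v w [px py].
  by rewrite mpolyXD mevalB !mevalM !mevalXU !px; ring.
move/(sr_face_below fF); apply; last first.
  apply: mnm_set_ge2 => //; rewrite -val_eqE neq_ltn !var_lt ij //.
by apply/belowN/below2; rewrite !var_lt ?ij ?kl ?eqxx ?orbT.
Qed.

(** Uses the t-coefficient of a 2-minor of X(t): each of its other terms contains an x-variable
    smaller than x_{i,k}. *)
Lemma face_no_xy F (i j : 'I_m) (k l : 'I_n) :
  sr_face (LT (@principal_ideal K m n)) F -> (i < j)%N -> (k < l)%N ->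
  xvar i k \in F -> yvar j l \in F -> False.
Proof.
move=> fF ij kl F1 F2.
pose x i j : R := 'X_(xvar i j). pose y i j : R := 'X_(yvar i j).
have : principal_ideal ('X_[U_(xvar i k) + U_(yvar j l)] +
    (y i k * x j l - y j k * x i l - y i l * x j k)).
  apply: principal_ideal_intro => p u z v w [px py].
  by rewrite mpolyXD !(mevalD, mevalN, mevalM) !mevalXU !px !py; ring.
move/(sr_face_below fF); apply; last first.
  by apply: mnm_set_ge2 => //; rewrite -val_eqE neq_ltn !var_lt.
by apply: belowD; [apply: belowD|]; [|apply: belowN..]; apply: below2;
  rewrite !var_lt ?ij ?kl ?eqxx ?orbT.
Qed.

(* The hypotheses on the order make the antidiagonal a3 b2 c1 the leading
   monomial of the determinant with rows a, b and c. *)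
Lemma face_no_antidiagonal3 F (a1 a2 a3 b1 b2 b3 c1 c2 c3 : 'I_(m * n + m * n)) :
  sr_face (LT (@principal_ideal K m n)) F ->
  (forall p u z v w, tangent_point p u z v w ->
     p a1 * (p b2 * p c3 - p b3 * p c2) - p a2 * (p b1 * p c3 - p b3 * p c1)
     + p a3 * (p b1 * p c2 - p b2 * p c1) = 0 :> K) ->
  (a3 < b3)%N -> (b2 < b3)%N ->
  (forall k, k \in [:: a3; b2; c1] -> (k < c2)%N && (k < c3)%N) ->
  uniq [:: a3; b2; c1] -> a3 \in F -> b2 \in F -> c1 \in F -> False.
Proof.
move=> fF det0 ab bb cc un F1 F2 F3.
have : principal_ideal ('X_[U_(a3) + U_(b2) + U_(c1)] +
    (- ('X_a2 * 'X_b3 * 'X_c1) + ('X_a1 * 'X_b3 * 'X_c2 + (- ('X_a3 * 'X_b1 * 'X_c2)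
     + ('X_a2 * 'X_b1 * 'X_c3 - 'X_a1 * 'X_b2 * 'X_c3)))) : R).
  apply: principal_ideal_intro => p u z v w /det0 e.
  rewrite !mpolyXD !(mevalD, mevalN, mevalM) !mevalXU; apply: (oppr_inj); rewrite oppr0 -[RHS]e.
  by ring.
move/(sr_face_below fF); apply; last exact: mnm_set_ge3.
have /andP[a2' a3'] := cc a3 (mem_head _ _).
have /andP[b2' b3'] : (b2 < c2)%N && (b2 < c3)%N by apply: cc; rewrite !inE eqxx orbT.
have /andP[c2' c3'] : (c1 < c2)%N && (c1 < c3)%N by apply: cc; rewrite !inE eqxx !orbT.
apply: belowD; first exact/belowN/below3_shift.
apply: belowD; first exact: below3.
apply: belowD; first exact/belowN/below3.
by apply: belowD; [exact: below3 | exact/belowN/below3].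
Qed.

(** Rows [i] and [j] of y and row [k] of x lie in the span of v and w, so their 3 x 3 determinants
    vanish. *)
Lemma face_no_xyy_rows F (i j k : 'I_m) (p q r : 'I_n) :
  sr_face (LT (@principal_ideal K m n)) F -> (i < j <= k)%N -> (p < q < r)%N ->
  xvar k p \in F -> yvar j q \in F -> yvar i r \in F -> False.
Proof.
move=> fF /andP[ij jk] /andP[pq qr] F1 F2 F3.
apply: (@face_no_antidiagonal3 F (yvar i p) (yvar i q) (yvar i r)
  (yvar j p) (yvar j q) (yvar j r) (xvar k p) (xvar k q) (xvar k r)) => //.
- by move=> x u z v w [px py]; rewrite !px !py; ring.
- by rewrite var_lt ij.
- by rewrite !var_lt qr orbT.
- by move=> l; rewrite !inE => /or3P[] /eqP->; rewrite !var_lt ?pq ?(ltn_trans pq qr) ?orbT.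
- by rewrite /= !inE -!val_eqE !negb_or !neq_ltn !var_lt ij ?orbT.
Qed.

(** The transposed argument: columns [p] and [q] of y and column [r] of x lie in the span of u and
    z. *)
Lemma face_no_xyy_cols F (i j k : 'I_m) (p q r : 'I_n) :
  sr_face (LT (@principal_ideal K m n)) F -> (i < j < k)%N -> (p < q <= r)%N ->
  xvar i r \in F -> yvar j q \in F -> yvar k p \in F -> False.
Proof.
move=> fF /andP[ij jk] /andP[pq qr] F1 F2 F3.
apply: (@face_no_antidiagonal3 F (yvar i p) (yvar j p) (yvar k p)
  (yvar i q) (yvar j q) (yvar k q) (xvar i r) (xvar j r) (xvar k r)) => //.
- by move=> x u z v w [px py]; rewrite !px !py; ring.
- by rewrite !var_lt pq orbT.
- by rewrite !var_lt jk.
- by move=> l; rewrite !inE => /or3P[] /eqP->; rewrite !var_lt ?ij ?(ltn_trans ij jk) ?orbT.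
- by rewrite /= !inE -!val_eqE !negb_or !neq_ltn !var_lt jk ?orbT.
Qed.

Lemma face_no_yyy F (i j k : 'I_m) (p q r : 'I_n) :
  sr_face (LT (@principal_ideal K m n)) F -> (i < j < k)%N -> (p < q < r)%N ->
  yvar i r \in F -> yvar j q \in F -> yvar k p \in F -> False.
Proof.
move=> fF /andP[ij jk] /andP[pq qr] F1 F2 F3.
apply: (@face_no_antidiagonal3 F (yvar i p) (yvar i q) (yvar i r)
  (yvar j p) (yvar j q) (yvar j r) (yvar k p) (yvar k q) (yvar k r)) => //.
- by move=> x u z v w [px py]; rewrite !py; ring.
- by rewrite var_lt ij.
- by rewrite !var_lt qr orbT.
- move=> l; rewrite !inE => /or3P[] /eqP->; rewrite !var_lt ?jk ?(ltn_trans ij jk) //.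
  by rewrite pq (ltn_trans pq qr) !orbT.
- by rewrite /= !inE -!val_eqE !negb_or !neq_ltn !var_lt ij jk (ltn_trans ij jk).
Qed.

End Nonfaces.

(** * Base B digits, and the variables as the cells of two grids *)

Lemma digits_inj (B k : nat) (f g : 'I_k -> nat) :
  (forall t, f t < B) -> (forall t, g t < B) ->
  \sum_t f t * B ^ t = \sum_t g t * B ^ t -> f =1 g.
Proof.
elim: k f g => [|k IHk] f g fB gB; first by move=> _ [].
rewrite !big_ord_recl !expn0 !muln1.
have shift (h : 'I_k.+1 -> nat) :
    \sum_(t < k) h (lift ord0 t) * B ^ lift ord0 t = (\sum_(t < k) h (lift ord0 t) * B ^ t) * B.
  by rewrite big_distrl; apply: eq_bigr => t _ /=; rewrite /bump /= expnS; ring.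
rewrite !shift => e.
have B_gt0 : 0 < B by apply: leq_ltn_trans (fB ord0).
have e0 : f ord0 = g ord0.
  have := congr1 (modn ^~ B) e.
  by rewrite !(addnC (_ ord0)) !modnMDl !modn_small.
have {}e : \sum_(t < k) f (lift ord0 t) * B ^ t = \sum_(t < k) g (lift ord0 t) * B ^ t.
  by move: e; rewrite e0 => /addnI /eqP; rewrite eqn_pmul2r // => /eqP.
move=> t; case: (unliftP ord0 t) => [t'|] -> //.
exact: (IHk (f \o lift ord0) (g \o lift ord0) (fun=> fB _) (fun=> gB _) e t').
Qed.

Lemma digits_finType_inj (B : nat) (T : finType) (f g : T -> nat) :
  (forall t, f t < B) -> (forall t, g t < B) ->
  \sum_t f t * B ^ enum_rank t = \sum_t g t * B ^ enum_rank t -> f =1 g.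
Proof.
move=> fB gB e t; rewrite -(enum_rankK t).
apply: (@digits_inj B _ (f \o enum_val) (g \o enum_val)) => [?|?|]; [exact: fB|exact: gB|].
rewrite !(reindex (@enum_rank T)) /=; try exact/onW_bij/enum_rank_bij.
by under eq_bigr => u _ do rewrite enum_rankK; under [RHS]eq_bigr => u _ do rewrite enum_rankK.
Qed.

Section Variables.
Variables m n : nat.
Notation cells := ('I_m * 'I_n)%type.

Lemma cell_inj : injective (fun p : cells => cell p.1 p.2).
Proof.
move=> [a b] [c d] /= e.
have : (cell a b < cell c d) = false by rewrite e ltnn.
have : (cell c d < cell a b) = false by rewrite e ltnn.
rewrite !cell_lt; case: (ltngtP a c) => // /val_inj ->; rewrite eqxx /=.
by case: (ltngtP b d) => // /val_inj ->.
Qed.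

Lemma cell_bij : bijective (fun p : cells => cell p.1 p.2).
Proof. by apply: inj_card_bij cell_inj _; rewrite card_prod !card_ord. Qed.

Variant var_spec : 'I_(m * n + m * n) -> Type :=
  | VarX a b : var_spec (xvar a b)
  | VarY a b : var_spec (yvar a b).

Lemma varP k : var_spec k.
Proof.
have ex_pos (l : 'I_(m * n)) : {p : cells | cell p.1 p.2 == l}.
  by apply: sigW; have [pos _ posK] := cell_bij; exists (pos l); rewrite (posK l).
case: (split_ordP k) => l ->; have [[a b] /eqP <-] := ex_pos l; [exact: VarY | exact: VarX].
Qed.

Lemma var_fun_exists (A : Type) (fx fy : cells -> A) : exists f : 'I_(m * n + m * n) -> A,
  (forall a b, f (xvar a b) = fx (a, b)) /\ (forall a b, f (yvar a b) = fy (a, b)).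
Proof.
have [pos cellK _] := cell_bij.
exists (fun k => match split k with inl l => fy (pos l) | inr l => fx (pos l) end).
split=> a b; first by rewrite (unsplitK (inr _)) (cellK (a, b)).
by rewrite (unsplitK (inl _)) (cellK (a, b)).
Qed.

Lemma big_var (R : Type) (idx : R) (op : Monoid.com_law idx) (f : 'I_(m * n + m * n) -> R) :
  \big[op/idx]_k f k =
  op (\big[op/idx]_(p : cells) f (yvar p.1 p.2)) (\big[op/idx]_(p : cells) f (xvar p.1 p.2)).
Proof.
rewrite big_split_ord; congr (op _ _); apply: reindex; exact/onW_bij/cell_bij.
Qed.

End Variables.

(** * Expansion of a monomial along the parametrization *)

Lemma sum_pair (I J : finType) (F : I * J -> nat) :
  \sum_p F p = \sum_a \sum_b F (a, b).
Proof. by rewrite pair_bigA; apply: eq_bigr => -[]. Qed.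

Section Evaluation.
Variables (K : closedFieldType) (m n : nat).
Notation cells := ('I_m * 'I_n)%type.
Notation N := (m * n + m * n).
Implicit Types (f : {mpoly K[N]}) (e : 'X_{1..N}).
Local Open Scope ring_scope.

(* If g is not zero, then g * 'X + 1 has a root, which is not 0 and at which g
   does not vanish. *)
Lemma poly_eq0_off0 (g : {poly K}) : (forall s, s != 0 -> g.[s] = 0) -> g = 0.
Proof.
move=> g0; apply/eqP; apply: contraT => g_neq0.
have /closed_rootP[s /rootP] : size (g * 'X + 1) != 1%N.
  rewrite size_polyDl size_mulX ?size_poly1 //.
    by rewrite eqSS size_poly_eq0.
  by rewrite ltnS size_poly_gt0.
rewrite hornerD hornerMX hornerC => gs.
have [s0|/g0 gs0] := eqVneq s 0.
  by move: gs; rewrite s0 mulr0 add0r => /eqP; rewrite oner_eq0.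
by move: gs; rewrite gs0 mul0r add0r => /eqP; rewrite oner_eq0.
Qed.

Variable B : nat.

(* One base-B digit for each of the variables u_a, v_b, w_b, z_a of the
   parametrization x_ab = u_a v_b, y_ab = u_a w_b + z_a v_b. *)
Definition param := (('I_m + 'I_n) + ('I_n + 'I_m))%type.
Definition weight (t : param) : nat := (B ^ enum_rank t)%N.
Definition wt_uv (p : cells) := (weight (inl (inl p.1)) + weight (inl (inr p.2)))%N.
Definition wt_uw (p : cells) := (weight (inl (inl p.1)) + weight (inr (inl p.2)))%N.
Definition wt_zv (p : cells) := (weight (inr (inr p.1)) + weight (inl (inr p.2)))%N.

Definition ex e (p : cells) := e (xvar p.1 p.2).
Definition ey e (p : cells) := e (yvar p.1 p.2).

(* q p is the number of factors y_p that contribute z v rather than u w. *)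
Definition expansion_deg e (q : cells -> nat) : nat :=
  (\sum_p wt_uv p * ex e p + \sum_p (wt_uw p * (ey e p - q p) + wt_zv p * q p))%N.

(** The exponents of u_a, v_b, w_b and z_a, in this order, in the term of the expansion chosen by
    [q]. *)
Definition expansion_margin e (q : cells -> nat) (t : param) : nat :=
  match t with
  | inl (inl a) => \sum_b ex e (a, b) + \sum_b (ey e (a, b) - q (a, b))
  | inl (inr b) => \sum_a ex e (a, b) + \sum_a q (a, b)
  | inr (inl b) => \sum_a (ey e (a, b) - q (a, b))
  | inr (inr a) => \sum_b q (a, b)
  end%N.

(** When the exponents in u, v, w and z are less than B, they are the base B digits of the degree,
    so passing to a single variable keeps distinct monomials in the parameters apart. *)
Lemma expansion_degE e q :
  expansion_deg e q = (\sum_t expansion_margin e q t * weight t)%N.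
Proof.
have sum_row (F : cells -> nat) (w : 'I_m -> nat) :
    (\sum_p w p.1 * F p = \sum_a (\sum_b F (a, b)) * w a)%N.
  rewrite sum_pair; apply: eq_bigr => a _.
  by rewrite big_distrl; apply: eq_bigr => b _; rewrite mulnC.
have sum_col (F : cells -> nat) (w : 'I_n -> nat) :
    (\sum_p w p.2 * F p = \sum_b (\sum_a F (a, b)) * w b)%N.
  rewrite sum_pair exchange_big; apply: eq_bigr => b _.
  by rewrite big_distrl; apply: eq_bigr => a _; rewrite mulnC.
rewrite !big_sumType /= /expansion_deg big_split /=.
have split_sum (F : cells -> nat) (w1 w2 : cells -> nat) :
    (\sum_p (w1 p + w2 p) * F p = \sum_p w1 p * F p + \sum_p w2 p * F p)%N.
  by rewrite -big_split; apply: eq_bigr => p _; rewrite mulnDl.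
rewrite !split_sum.
rewrite !(sum_row _ (fun a => weight (inl (inl a)))) !(sum_col _ (fun b => weight (inl (inr b)))).
rewrite (sum_row _ (fun a => weight (inr (inr a)))) (sum_col _ (fun b => weight (inr (inl b)))).
have mulD (I : finType) (F G : I -> nat) (w : I -> nat) :
    (\sum_i (F i + G i) * w i = \sum_i F i * w i + \sum_i G i * w i)%N.
  by rewrite -big_split; apply: eq_bigr => p _; rewrite mulnDl.
rewrite !mulD; ring.
Qed.

Lemma mdeg_cells e : mdeg e = (\sum_p ey e p + \sum_p ex e p)%N.
Proof. by rewrite mdegE big_var. Qed.

Lemma expansion_margin_le e q t :
  (forall p, q p <= ey e p)%N -> (expansion_margin e q t <= mdeg e)%N.
Proof.
move=> qe; rewrite mdeg_cells.
have row (F G : cells -> nat) a : (forall p, F p <= G p)%N -> (\sum_b F (a, b) <= \sum_p G p)%N.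
  move=> FG; rewrite sum_pair (bigD1 a) //=.
  by apply: leq_trans (leq_addr _ _); apply: leq_sum.
have col (F G : cells -> nat) b : (forall p, F p <= G p)%N -> (\sum_a F (a, b) <= \sum_p G p)%N.
  move=> FG; rewrite sum_pair exchange_big (bigD1 b) //=.
  by apply: leq_trans (leq_addr _ _); apply: leq_sum.
case: t => [[a|b]|[b|a]] /=.
- by rewrite addnC leq_add ?(row (fun p => ey e p - q p)%N) ?row // => p; apply: leq_subr.
- by rewrite addnC leq_add ?col.
- by rewrite (leq_trans _ (leq_addr _ _)) // (col (fun p => ey e p - q p)%N) // => p; apply: leq_subr.
- by rewrite (leq_trans _ (leq_addr _ _)) // row.
Qed.

Lemma expansion_deg_inj e e' q q' :
  (forall p, q p <= ey e p)%N -> (forall p, q' p <= ey e' p)%N ->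
  (mdeg e < B)%N -> (mdeg e' < B)%N -> expansion_deg e q = expansion_deg e' q' ->
  expansion_margin e q =1 expansion_margin e' q'.
Proof.
move=> qe qe' eB eB'; rewrite !expansion_degE; apply: digits_finType_inj => t.
  exact: leq_ltn_trans (expansion_margin_le _ qe) eB.
exact: leq_ltn_trans (expansion_margin_le _ qe') eB'.
Qed.

Variable V : 'I_N -> {poly K}.
Hypothesis Vx : forall a b, V (xvar a b) = 'X^(wt_uv (a, b)).
Hypothesis Vy : forall a b, V (yvar a b) = 'X^(wt_uw (a, b)) + 'X^(wt_zv (a, b)).

Lemma prod_expansion e : (mdeg e < B)%N ->
  \prod_k V k ^+ e k =
  \sum_(q : {ffun cells -> 'I_B})
     (\prod_p 'C(ey e p, q p))%:R *: 'X^(expansion_deg e (fun p => q p)).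
Proof.
move=> eB; rewrite big_var /= mulrC.
have -> : \prod_p V (xvar p.1 p.2) ^+ e (xvar p.1 p.2) = 'X^(\sum_p wt_uv p * ex e p).
  by rewrite expr_sum; apply: eq_bigr => -[a b] _; rewrite Vx -exprM.
have binom p : V (yvar p.1 p.2) ^+ e (yvar p.1 p.2) =
    \sum_(i < B) 'C(ey e p, i)%:R *: 'X^(wt_uw p * (ey e p - i) + wt_zv p * i).
  case: p => a b; rewrite Vy exprDn.
  have lt_e : (ey e (a, b) < B)%N.
    by apply: leq_ltn_trans eB; rewrite mdegE (bigD1 (yvar a b)) //= leq_addr.
  (* The sum is extended to all [i < B], with binomial coefficients 0, so that [q] has the same
     index type for all monomials. *)
  rewrite (big_ord_widen _ (fun i =>
    ('X^(wt_uw (a, b)) ^+ (ey e (a, b) - i) * 'X^(wt_zv (a, b)) ^+ i) *+ 'C(ey e (a, b), i)) lt_e).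
  rewrite big_mkcond; apply: eq_bigr => i _ /=.
  rewrite -!exprM -exprD -scaler_nat; case: ifP => // /negbT; rewrite -ltnNge => lt_i.
  by rewrite bin_small // scale0r.
rewrite (eq_bigr _ (fun p _ => binom p)) bigA_distr_bigA big_distrr /=; apply: eq_bigr => q _.
by rewrite scaler_prod natr_prod -expr_sum -scalerAr -exprD.
Qed.

End Evaluation.

(** * Unions of paths are faces *)

Section Faces.
Variables (K : closedFieldType) (m n : nat).
Notation N := (m * n + m * n).
Notation cells := ('I_m * 'I_n)%type.
Implicit Types (f : {mpoly K[N]}) (e : 'X_{1..N}) (X P Q S : {set cells}).
Local Open Scope ring_scope.

(** In equal degrees the smaller monomial has the larger exponent at the last difference. *)
Lemma eq_or_grevlex_lt_last e e0 : e = e0 \/ grevlex_lt e e0 -> mdeg e = mdeg e0 ->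
  forall k : 'I_N, (forall l : 'I_N, (k < l)%N -> e l = e0 l) -> (e0 k <= e k)%N.
Proof.
case=> [-> //|+ dege]; rewrite /grevlex_lt dege ltnn eqxx /= => /existsP[l /andP[lt_l /forallP H]].
move=> k agr; case: (ltngtP k l) => [kl|lk|/val_inj ->]; last exact: ltnW.
  by rewrite agr ?ltnn in lt_l.
by have /implyP/(_ lk)/eqP-> := H k.
Qed.

Lemma grevlex_lt_mdeg e e0 : e = e0 \/ grevlex_lt e e0 -> (mdeg e <= mdeg e0)%N.
Proof. by case=> [->//|/orP[/ltnW//|/andP[/eqP->]]]. Qed.

(** The monomial occurs in some summand, hence is a multiple of the leading monomial of an element
    of [L], which is then multiplied by the quotient. *)
Lemma mem_LT_lead f0 (L : {mpoly K[N]} -> Prop) e0 :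
  (forall f g, L f -> L (f * g)) -> f0 = 'X_[e0] -> LT L f0 ->
  exists f, [/\ L f, e0 \in msupp f & forall e, e \in msupp f -> e = e0 \/ grevlex_lt e e0].
Proof.
move=> LM -> [s [sP Es]].
have /hasP[p ps nz] : has (fun p => (p.1 * p.2)@_e0 != 0) s.
  apply: contraT => /hasPn s0; have := congr1 (mcoeff e0) Es.
  rewrite mcoeffX eqxx raddf_sum big_seq big1 => [/eqP|p /s0]; first by rewrite oner_eq0.
  by rewrite negbK => /eqP.
have [f Lf [d [dsupp dlead Ep]]] := sP p ps.
have le_d : (d <= e0)%MM.
  move: nz; rewrite Ep -scalerAr mcoeffZ mulf_eq0 negb_or => /andP[_].
  rewrite -mcoeff_msupp (perm_mem (msuppMX _ _)) => /mapP[e _ ->].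
  exact: lem_addr.
exists (f * 'X_[e0 - d]); split; first exact: LM.
  by rewrite (perm_mem (msuppMX _ _)); apply/mapP; exists d; rewrite // submK.
move=> e; rewrite (perm_mem (msuppMX _ _)) => /mapP[e' e'supp ->].
have [->|ne] := eqVneq e' d; first by left; rewrite submK.
right; rewrite -[in X in grevlex_lt _ X](submK le_d) [X in grevlex_lt _ X]addmC.
by rewrite ![(_ - _ + _)%MM]addmC grevlex_ltD2r dlead.
Qed.

(** Each factor u v, u w or z v contains exactly one of the u and z. *)
Lemma mdeg_expansion_margin e (q : cells -> nat) : (forall p, q p <= ey e p)%N ->
  mdeg e = (\sum_a expansion_margin e q (inl (inl a)) +
            \sum_a expansion_margin e q (inr (inr a)))%N.
Proof.
move=> qe; rewrite mdeg_cells !sum_pair /= big_split /= -[RHS]addnA addnC.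
congr (_ + _)%N; rewrite -big_split; apply: eq_bigr => a _.
by rewrite -big_split; apply: eq_bigr => b _; rewrite /= subnK.
Qed.

Definition of_parts X S : {set 'I_N} :=
  [set xvar p.1 p.2 | p in X] :|: [set yvar p.1 p.2 | p in S].

Lemma mem_of_parts X S :
  (forall a b, (xvar a b \in of_parts X S) = ((a, b) \in X)) /\
  (forall a b, (yvar a b \in of_parts X S) = ((a, b) \in S)).
Proof.
have xinj : injective (fun p : cells => xvar p.1 p.2).
  by move=> p q /rshift_inj; apply: cell_inj.
have yinj : injective (fun p : cells => yvar p.1 p.2).
  by move=> p q /lshift_inj; apply: cell_inj.
have yx (p q : cells) : yvar p.1 p.2 != xvar q.1 q.2.
  by rewrite -val_eqE neq_ltn yvar_lt_xvar.
split=> a b; rewrite inE.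
  rewrite (mem_imset _ (a, b) xinj) orbC; case: imsetP => // -[p _ /eqP].
  by rewrite eq_sym (negbTE (yx p (a, b))).
rewrite (mem_imset _ (a, b) yinj); case: imsetP => // -[p _ /eqP].
by rewrite (negbTE (yx (a, b) p)).
Qed.

Lemma principal_idealM f g : principal_ideal (n := n) f -> principal_ideal (n := n) (f * g).
Proof. by move=> f0 p /f0 e; rewrite mevalM e mul0r. Qed.

(** For s nonzero, taking powers of s for u, v, w and z gives a point of the principal component, so
    every nonzero s is a root of this polynomial. *)
Lemma eval_tangent_poly (V : 'I_N -> {poly K}) B f :
  (0 < m)%N -> (0 < n)%N ->
  (forall a b, V (xvar a b) = 'X^(wt_uv B (a, b))) ->
  (forall a b, V (yvar a b) = 'X^(wt_uw B (a, b)) + 'X^(wt_zv B (a, b))) ->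
  principal_ideal f -> \sum_(e <- msupp f) f@_e *: \prod_k V k ^+ e k = 0.
Proof.
move=> m_gt0 n_gt0 Vx Vy f0; apply: poly_eq0_off0 => s s_neq0.
pose h (t : param m n) := s ^+ weight B t.
have tp : tangent_point (fun k => (V k).[s]) (fun a => h (inl (inl a)))
    (fun a => h (inr (inr a))) (fun b => h (inl (inr b))) (fun b => h (inr (inl b))).
  split=> a b; first by rewrite Vx hornerXn /wt_uv exprD.
  by rewrite Vy hornerD !hornerXn /wt_uw /wt_zv !exprD.
have pc := tangent_point_mem (a := Ordinal m_gt0) (b := Ordinal n_gt0) tp
  (expf_neq0 _ s_neq0) (expf_neq0 _ s_neq0).
rewrite horner_sum -[RHS](f0 _ pc) mevalE; apply: eq_bigr => e _.
rewrite hornerZ horner_prod; congr (_ * _); apply: eq_bigr => k _.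
by rewrite horner_exp.
Qed.

Lemma of_parts_face X P Q (i : 'I_m) (j : 'I_n) :
  chain_set X -> chain_set P -> chain_set Q ->
  (forall p, p \in X -> (i <= p.1)%N /\ (j <= p.2)%N) ->
  (forall p, p \in P -> (p.1 <= i)%N) -> (forall p, p \in Q -> (p.2 <= j)%N) ->
  [disjoint P & Q] ->
  sr_face (LT (@principal_ideal K m n)) (of_parts X (P :|: Q)).
Proof.
move=> chX chP chQ geX leP leQ dPQ.
have [memx memy] := mem_of_parts X (P :|: Q).
set G := of_parts X (P :|: Q) in memx memy *; pose e0 := mnm_set G.
move/(mem_LT_lead principal_idealM (prod_mpolyX _ G)); rewrite -/e0.
case=> f [f0 e0f fle].
(* Larger than the degree of every monomial of [f], and at least 2 so that [q0] can take the value
   1. *)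
pose B := (mdeg e0).+2.
have [V [Vx Vy]] := @var_fun_exists m n {poly K}
  (fun p => 'X^(wt_uv B p)) (fun p => 'X^(wt_uw B p) + 'X^(wt_zv B p)).
have m_gt0 : (0 < m)%N by apply: leq_ltn_trans (ltn_ord i).
have n_gt0 : (0 < n)%N by apply: leq_ltn_trans (ltn_ord j).
(* The term taking u w at the cells of [P] and z v at those of [Q]. *)
pose q0 : {ffun cells -> 'I_B} := [ffun p => inord (p \in Q)].
have q0E p : q0 p = (p \in Q) :> nat by rewrite ffunE inordK //; case: (p \in Q).
have exE p : ex e0 p = (p \in X) by case: p => a b; rewrite /ex mnmE memx.
have eyE p : ey e0 p = ((p \in P) + (p \in Q))%N.
  case: p => a b; rewrite /ey mnmE memy inE.
  have [aP|//] := boolP ((a, b) \in P).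
  by rewrite (disjointFr dPQ aP).
have q0_le p : (q0 p <= ey e0 p)%N by rewrite q0E eyE leq_addl.
have coefE e (q : {ffun cells -> 'I_B}) : e \in msupp f ->
    (forall p, (q p <= ey e p)%N) ->
    expansion_deg B e (fun p => q p) = expansion_deg B e0 (fun p => q0 p) ->
    e = e0 /\ q = q0.
  move=> ef qe.
  have le_e := fle e ef.
  have eB : (mdeg e < B)%N by apply: leq_trans (grevlex_lt_mdeg le_e) _.
  have e0B : (mdeg e0 < B)%N by [].
  move/(expansion_deg_inj qe q0_le eB e0B) => marg.
  have xE a b : ex e0 (a, b) = ((a, b) \in X) :> nat by rewrite exE.
  have pE a b : (ey e0 (a, b) - q0 (a, b))%N = ((a, b) \in P) :> nat.
    by rewrite eyE q0E addnK.
  have qE a b : q0 (a, b) = ((a, b) \in Q) :> nat by rewrite q0E.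
  have dege : mdeg e = mdeg e0.
    rewrite (mdeg_expansion_margin qe) (mdeg_expansion_margin q0_le).
    by congr (_ + _)%N; apply: eq_bigr => a _; rewrite marg.
  have last := eq_or_grevlex_lt_last le_e dege.
  have E a b : [/\ ex e (a, b) = ex e0 (a, b),
      (ey e (a, b) - q (a, b) = ey e0 (a, b) - q0 (a, b))%N
      & q (a, b) = q0 (a, b) :> nat].
    apply: (@margins_exchange m n (fun a b => ex e0 (a, b))
      (fun a b => ey e0 (a, b) - q0 (a, b))%N (fun a b => q0 (a, b))
      (fun a b => ex e (a, b)) (fun a b => ey e (a, b) - q (a, b))%N (fun a b => q (a, b)) i j).
    - by move=> c c' d d' lt_c; rewrite !xE !lt0b => h h'; apply: chX h h' lt_c.
    - by move=> c c' d d' lt_c; rewrite !pE !lt0b => h h'; apply: chP h h' lt_c.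
    - by move=> c c' d d' lt_c; rewrite !qE !lt0b => h h'; apply: chQ h h' lt_c.
    - by move=> c d; rewrite xE lt0b => /geX.
    - by move=> c d; rewrite pE lt0b => /leP.
    - by move=> c d; rewrite qE lt0b => /leQ.
    - by move=> c; apply: (marg (inl (inl c))).
    - by move=> d; apply: (marg (inl (inr d))).
    - by move=> d; apply: (marg (inr (inl d))).
    - by move=> c; apply: (marg (inr (inr c))).
    (* The x-variables come after all y-variables, so the last difference among the x-exponents is
       the last one overall. *)
    - move=> c d agr; apply: last => l; case: (varP l) => c' d'.
        by rewrite /= ltn_add2l; apply: agr.
      by rewrite ltnNge ltnW ?yvar_lt_xvar.
    - move=> exx c d agr; rewrite !subnK //; apply: last => l; case: (varP l) => c' d'.
        by move=> _; apply: exx.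
      by move=> lt_l; have := agr c' d' lt_l; rewrite !subnK.
  split.
    apply/mnmP => l; case: (varP l) => a b; have [xx yy qq] := E a b; first exact: xx.
    by have := qe (a, b); have := q0_le (a, b); rewrite /ey /= in yy *; lia.
  by apply/ffunP => -[a b]; apply: val_inj; have [] := E a b.
(* This coefficient of the zero polynomial equals that of [e0] in [f]: only [q0] in [e0]
   contributes, and its binomial coefficients are all 1. *)
have := congr1 (fun g : {poly K} => g`_(expansion_deg B e0 (fun p => q0 p)))
  (eval_tangent_poly m_gt0 n_gt0 Vx Vy f0).
have eB e : e \in msupp f -> (mdeg e < B)%N.
  by move=> /fle /grevlex_lt_mdeg le_e; apply: leq_trans le_e _.
rewrite coef0 coef_sum (bigD1_seq e0) //= [X in _ + X]big_seq_cond [X in _ + X]big1 => [|e /andP[ef ne]]; last first.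
  rewrite coefZ (prod_expansion Vx Vy (eB e ef)) coef_sum big1 ?mulr0 // => q _.
  rewrite coefZ coefXn; case: eqP => [Ed|_]; last by rewrite mulr0.
  rewrite mulr1; have [/forallP qe|/forallPn[p]] := boolP [forall p, (q p <= ey e p)%N].
    by have [e_e0 _] := coefE e q ef qe (esym Ed); rewrite e_e0 eqxx in ne.
  by rewrite -ltnNge => lt_q; rewrite (bigD1 p) //= bin_small.
rewrite addr0 coefZ (prod_expansion Vx Vy (eB e0 e0f)) coef_sum (bigD1 q0) //= [X in _ + X]big1 => [|q ne].
  rewrite addr0 coefZ coefXn eqxx mulr1 big1 ?mulr1 => [|p _].
    by move=> fe; have := e0f; rewrite mcoeff_msupp fe eqxx.
  rewrite q0E eyE; have [pQ|_] := boolP (p \in Q); last by rewrite bin0.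
  by rewrite (disjointFl dPQ pQ).
rewrite coefZ coefXn; case: eqP => [Ed|_]; last by rewrite mulr0.
rewrite mulr1; have [/forallP qe|/forallPn[p]] := boolP [forall p, (q p <= ey e0 p)%N].
  by have [_ q_q0] := coefE e0 q e0f qe (esym Ed); rewrite q_q0 eqxx in ne.
by rewrite -ltnNge => lt_q; rewrite (bigD1 p) //= bin_small.
Qed.

End Faces.

(** Stated for any cell [(i, j)] with these bounds on [F], and not only for mu(F), so that it also
    applies to the cell left of the last one. *)
Lemma facet_paths (K : closedFieldType) (m n : nat) (F : {set 'I_(m * n + m * n)})
    (i : 'I_m) (j : 'I_n) : 1 < m -> 1 < n -> (i < m.-1) || (j < n.-1) ->
  sr_facet (LT (@principal_ideal K m n)) F ->
  (forall p, p \in xpart F -> i <= p.1 /\ j <= p.2) ->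
  (forall p, p \in ypart F -> (p.1 <= i) || (p.2 <= j)) ->
  (forall p q, p \in ypart F -> q \in ypart F -> p.1 < q.1 -> q.2 < p.2 ->
     q.1 <= i -> q.2 <= j) ->
  (forall p q, p \in ypart F -> q \in ypart F -> p.1 < q.1 -> q.2 < p.2 ->
     i < p.1 -> False) ->
  is_path (xpart F) (i : nat, j : nat) (m.-1, n.-1) /\
  exists P Q : {set 'I_m * 'I_n},
    [/\ is_path P (0, 0) (i : nat, n.-1), is_path Q (1, 0) (m.-1, j : nat),
        [disjoint P & Q] & ypart F = P :|: Q].
Proof.
move=> m_gt1 n_gt1 ij [faceF maxF] geF yB yC yD.
have chF : chain_set (xpart F).
  move=> [a b] [c d]; rewrite !inE /= => F1 F2 ac; rewrite leqNgt; apply/negP => db.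
  exact: face_no_xx faceF ac db F1 F2.
have yE (p q r : 'I_m * 'I_n) : p \in ypart F -> q \in ypart F -> r \in ypart F ->
    p.1 < q.1 < r.1 -> r.2 < q.2 < p.2 -> False.
  by rewrite !inE => F1 F2 F3 rows cols; apply: face_no_yyy faceF rows cols F1 F2 F3.
have [X [P [Q [pX pP pQ dPQ [FX FPQ]]]]] := cover_by_paths m_gt1 n_gt1
  (ltn_ord i) (ltn_ord j) ij chF geF yB yC yD yE.
have faceG : sr_face (LT (@principal_ideal K m n)) (of_parts X (P :|: Q)).
  apply: (of_parts_face (i := i) (j := j)) => //.
  - exact: is_path_chain pX.
  - exact: is_path_chain pP.
  - exact: is_path_chain pQ.
  - by move=> p /(is_path_bounds pX)[].
  - by move=> p /(is_path_bounds pP)[].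
  - by move=> p /(is_path_bounds pQ)[].
have [memx memy] := mem_of_parts X (P :|: Q).
have sFG : F \subset of_parts X (P :|: Q).
  apply/subsetP => k; case: (varP k) => a b kF.
    by rewrite memx (subsetP FX) // inE.
  by rewrite memy (subsetP FPQ) // inE.
have EF := maxF _ faceG sFG.
have <- : X = xpart F by apply/setP => -[a b]; rewrite inE -EF memx.
split=> //; exists P, Q; split=> //.
by apply/setP => -[a b]; rewrite inE -EF memy.
Qed.

Theorem theorem2p5 (K : closedFieldType) (m n : nat)
  (hm : (2 <= m)%N) (hmn : (m <= n)%N)
  (F : {set 'I_(m * n + m * n)}) (i : 'I_m) (j : 'I_n)
  (hF : sr_facet (LT (@principal_ideal K m n)) F)
  (hmu : is_mu F i j) :
  is_path (xpart F) (i : nat, j : nat) (m.-1, n.-1) /\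
  exists P Q : {set 'I_m * 'I_n},
    [/\ is_path P (0, 0)%N (i : nat, n.-1),
        is_path Q (1, 0)%N (m.-1, j : nat),
        [disjoint P & Q]
      & ypart F = P :|: Q].
Proof.
case: hmu => mu_in mu_min.
have n_gt1 : 1 < n by apply: leq_trans hmn.
have [faceF maxF] := hF.
have geF (p : 'I_m * 'I_n) : p \in xpart F -> i <= p.1 /\ j <= p.2.
  by rewrite inE => /mu_min.
have [ij|ij] := boolP ((i < m.-1) || (j < n.-1)).
  (* The nonfaces x y and x y y that involve mu(F) give the three conditions on [ypart F]. *)
  apply: facet_paths hF geF _ _ _ => //.
  - move=> [a b]; rewrite inE /= => F1; apply: contraT; rewrite negb_or -!ltnNge => /andP[ia jb].
    by case: (face_no_xy faceF ia jb mu_in F1).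
  - move=> [a b] [c d]; rewrite !inE /= => F1 F2 ac db ci; rewrite leqNgt; apply/negP => jd.
    by apply: (face_no_xyy_rows faceF _ _ mu_in F2 F1); apply/andP.
  - move=> [a b] [c d]; rewrite !inE /= => F1 F2 ac db ia.
    have bj : b <= j.
      rewrite leqNgt; apply/negP => jb; exact: (face_no_xy faceF ia jb mu_in F1).
    by apply: (face_no_xyy_cols faceF _ _ mu_in F1 F2); apply/andP.
(* If mu(F) were the last variable, F would be covered by paths starting one
   column earlier, which contradicts the minimality of mu(F). *)
have [im jn] : i = m.-1 :> nat /\ j = n.-1 :> nat.
  by have := ltn_ord i; have := ltn_ord j; lia.
have lt_j' : n.-2 < n by lia.
have [] := @facet_paths K m n F i (Ordinal lt_j') hm n_gt1 _ hF.
- by rewrite /=; lia.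
- by move=> p /geF[] /=; lia.
- by move=> [a b] _ /=; have := ltn_ord a; lia.
- by move=> [a b] [c d] _ _ /=; have := ltn_ord b; lia.
- by move=> [a b] [c d] _ _ /=; have := ltn_ord c; lia.
case=> p [s [p_eq _ _ Ep]] _.
have /geF[_] : p \in xpart F by rewrite Ep inE mem_head.
by case: p_eq => _ ->; rewrite /=; lia.
Qed.
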